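(* Let $F\colon\mathcal C\to\mathcal D$ be a tensor functor between finite tensor categories admitting a right adjoint $F^{\mathrm{ra}}\colon\mathcal D\to\mathcal C$. (i) If the lax monoidal functor $F^{\mathrm{ra}}$ admits a Frobenius monoidal structure, then $F$ is Frobenius. (ii) If $F^{\mathrm{ra}}$ is exact and faithful, then $F$ being Frobenius implies that the induced lax and oplax monoidal structures turn $F^{\mathrm{ra}}$ into a Frobenius monoidal functor.
   Context: Work over an algebraically closed field $\Bbbk$; all categories are finite $\Bbbk$-linear abelian and functors are $\Bbbk$-linear. A finite tensor category is a finite $\Bbbk$-linear abelian rigid monoidal category with bilinear tensor product and $\mathrm{End}(\mathbb 1)\cong\Bbbk$; a tensor functor is an exact $\Bbbk$-linear strong monoidal functor. $F^{\mathrm{la}},F^{\mathrm{ra}}$ denote the left and right adjoints of $F$. A functor $F$ is Frobenius if it has both adjoints and $F^{\mathrm{la}}\cong F^{\mathrm{ra}}$ as $\Bbbk$-linear functors. Since $F$ is strong monoidal, $F^{\mathrm{ra}}$ has an induced lax monoidal structure and $F^{\mathrm{la}}$ has an induced oplax monoidal structure; when $F$ is Frobenius, $F^{\mathrm{ra}}$ also inherits an oplax monoidal structure from $F^{\mathrm{la}}$ using the isomorphism $F^{\mathrm{la}}\cong F^{\mathrm{ra}}$. A Frobenius monoidal functor is a functor $G$ with a lax monoidal structure $(G_2,G_0)$ and an oplax monoidal structure $(G^2,G^0)$ such that for all objects $c,c',c''$ $(\mathrm{id}\otimes G_2(c',c''))(G^2(c,c')\otimes\mathrm{id})=G^2(c,c'\otimes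 c'')\,G_2(c\otimes c',c'')$ and $(G_2(c,c')\otimes\mathrm{id})(\mathrm{id}\otimes G^2(c',c''))=G^2(c\otimes c',c'')\,G_2(c,c'\otimes c'')$.
   Formalization: In (ii) the oplax structure on F^ra is transported along a suitably chosen isomorphism F^la ≅ F^ra, which is shown to exist for every left adjoint; for an arbitrary k-linear isomorphism the claim fails (e.g. F = Id on Z/2-graded vector spaces with a rescaled isomorphism). *)

(* Defs.v *)
From HB Require Import structures.
From mathcomp Require Import all_boot all_algebra.

Set Implicit Arguments.
Unset Strict Implicit.
Unset Printing Implicit Defensive.

Import GRing.Theory.
Local Open Scope ring_scope.

Declare Scope cat_scope.
Delimit Scope cat_scope with cat.
Open Scope cat_scope.

Reserved Notation "g ∘ f" (at level 45, left associativity).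
Reserved Notation "x ⊗ y" (at level 40, left associativity).
Reserved Notation "f ⊗ₘ g" (at level 40, left associativity).

(** * Linear and abelian categories *)

Record linear_category (k : fieldType) := LinearCategory {
  ob :> Type;
  hom : ob -> ob -> lmodType k;
  idm : forall x, hom x x;
  comp : forall x y z, hom y z -> hom x y -> hom x z;
  compA : forall w x y z (h : hom y z) (g : hom x y) (f : hom w x),
    comp h (comp g f) = comp (comp h g) f;
  comp1m : forall x y (f : hom x y), comp (idm y) f = f;
  compm1 : forall x y (f : hom x y), comp f (idm x) = f;
  comp_linearr : forall x y z (g : hom y z), linear (fun f : hom x y => comp g f);
  comp_linearl : forall x y z (f : hom x y), linear (fun g : hom y z => comp g f)
}.

Arguments idm {k l} x.
Arguments comp {k l x y z} g f.

Notation "g ∘ f" := (comp g f) : cat_scope.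

Section Abelian.
Variables (k : fieldType) (C : linear_category k).
Implicit Types x y z : C.

Definition is_iso x y (f : hom x y) : Prop :=
  exists g : hom y x, g ∘ f = idm x /\ f ∘ g = idm y.

Definition isomorphic x y : Prop := exists f : hom x y, is_iso f.

Definition is_mono x y (f : hom x y) : Prop :=
  forall w (u v : hom w x), f ∘ u = f ∘ v -> u = v.

Definition is_epi x y (f : hom x y) : Prop :=
  forall z (u v : hom y z), u ∘ f = v ∘ f -> u = v.

Definition is_zero_object z : Prop :=
  forall x, (forall f : hom x z, f = 0) /\ (forall f : hom z x, f = 0).

Definition is_kernel w x y (i : hom w x) (f : hom x y) : Prop :=
  f ∘ i = 0 /\
  forall v (u : hom v x), f ∘ u = 0 -> exists! u' : hom v w, i ∘ u' = u.

Definition is_cokernel x y z (p : hom y z) (f : hom x y) : Prop :=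
  p ∘ f = 0 /\
  forall v (u : hom y v), u ∘ f = 0 -> exists! u' : hom z v, u' ∘ p = u.

Definition is_biproduct x y s
    (i1 : hom x s) (i2 : hom y s) (p1 : hom s x) (p2 : hom s y) : Prop :=
  [/\ p1 ∘ i1 = idm x, p2 ∘ i2 = idm y, p1 ∘ i2 = 0, p2 ∘ i1 = 0
    & (i1 ∘ p1) + (i2 ∘ p2) = idm s].

Record is_abelian : Prop := IsAbelian {
  ab_zero : exists z, is_zero_object z;
  ab_biproduct : forall x y, exists s (i1 : hom x s) (i2 : hom y s) p1 p2,
    is_biproduct i1 i2 p1 p2;
  ab_kernel : forall x y (f : hom x y), exists w (i : hom w x), is_kernel i f;
  ab_cokernel : forall x y (f : hom x y), exists z (p : hom y z), is_cokernel p f;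
  ab_mono : forall x y (f : hom x y), is_mono f ->
    exists z (g : hom y z), is_kernel f g;
  ab_epi : forall x y (f : hom x y), is_epi f ->
    exists w (g : hom w x), is_cokernel f g
}.

Definition short_exact x y z (f : hom x y) (g : hom y z) : Prop :=
  is_kernel f g /\ is_cokernel g f.

Definition is_simple x : Prop :=
  ~ is_zero_object x /\
  forall y (f : hom y x), is_mono f -> f = 0 \/ is_iso f.

Inductive finite_length : C -> Prop :=
| FiniteLengthZero z : is_zero_object z -> finite_length z
| FiniteLengthExt x y s (f : hom x y) (g : hom y s) :
    short_exact f g -> finite_length x -> is_simple s -> finite_length y.

Definition is_projective p : Prop :=
  forall x y (e : hom x y) (f : hom p y), is_epi e -> exists g, e ∘ g = f.

(* Intrinsic form of "equivalent to the finite-dimensional modules over a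
   finite-dimensional algebra" (Etingof-Gelaki-Nikshych-Ostrik). *)
Record is_finite_abelian : Prop := IsFiniteAbelian {
  fin_abelian : is_abelian;
  fin_hom : forall x y, exists n (f : {linear hom x y -> 'rV[k]_n}), bijective f;
  fin_length : forall x, finite_length x;
  fin_projective : forall x, exists p (e : hom p x), is_projective p /\ is_epi e;
  fin_simple : exists n (s : 'I_n -> C), forall x, is_simple x ->
    exists i, isomorphic x (s i)
}.

End Abelian.

(** * Linear functors, natural isomorphisms, adjunctions *)

Record linear_functor (k : fieldType) (C D : linear_category k) := LinearFunctor {
  fob :> C -> D;
  fmap : forall x y, hom x y -> hom (fob x) (fob y);
  fmap1 : forall x, fmap (idm x) = idm (fob x);
  fmapM : forall x y z (g : hom y z) (f : hom x y),
    fmap (g ∘ f) = fmap g ∘ fmap f;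
  fmap_linear : forall x y, linear (@fmap x y)
}.

Arguments fmap {k C D} l {x y} f.

Section Functors.
Variables (k : fieldType) (C D : linear_category k).

Definition is_exact (F : linear_functor C D) : Prop :=
  forall x y z (f : hom x y) (g : hom y z),
    short_exact f g -> short_exact (fmap F f) (fmap F g).

Definition is_faithful (F : linear_functor C D) : Prop :=
  forall x y (f g : hom x y), fmap F f = fmap F g -> f = g.

Record nat_iso (F G : linear_functor C D) := NatIso {
  nat_fun :> forall x, hom (F x) (G x);
  nat_inv : forall x, hom (G x) (F x);
  nat_invK : forall x, nat_inv x ∘ nat_fun x = idm (F x);
  nat_funK : forall x, nat_fun x ∘ nat_inv x = idm (G x);
  nat_natural : forall x y (f : hom x y),
    nat_fun y ∘ fmap F f = fmap G f ∘ nat_fun x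
}.

(* [adjunction F R]: F is left adjoint to R. *)
Record adjunction (F : linear_functor C D) (R : linear_functor D C) := Adjunction {
  adj_unit : forall c, hom c (R (F c));
  adj_counit : forall d, hom (F (R d)) d;
  adj_unit_natural : forall c c' (f : hom c c'),
    adj_unit c' ∘ f = fmap R (fmap F f) ∘ adj_unit c;
  adj_counit_natural : forall d d' (f : hom d d'),
    adj_counit d' ∘ fmap F (fmap R f) = f ∘ adj_counit d;
  adj_triangle_left : forall c,
    adj_counit (F c) ∘ fmap F (adj_unit c) = idm (F c);
  adj_triangle_right : forall d,
    fmap R (adj_counit d) ∘ adj_unit (R d) = idm (R d)
}.

End Functors.

Definition is_frobenius (k : fieldType) (C D : linear_category k)
    (F : linear_functor C D) : Prop :=
  exists L R : linear_functor D C,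
    [/\ inhabited (adjunction L F), inhabited (adjunction F R)
      & inhabited (nat_iso L R)].

(** * Finite tensor categories *)

Record monoidal_category (k : fieldType) := MonoidalCategory {
  mon_cat :> linear_category k;
  tens : mon_cat -> mon_cat -> mon_cat;
  tensm : forall x x' y y',
    hom x x' -> hom y y' -> hom (tens x y) (tens x' y');
  one : mon_cat;
  assoc : forall x y z, hom (tens (tens x y) z) (tens x (tens y z));
  assoc_inv : forall x y z, hom (tens x (tens y z)) (tens (tens x y) z);
  lunit : forall x, hom (tens one x) x;
  lunit_inv : forall x, hom x (tens one x);
  runit : forall x, hom (tens x one) x;
  runit_inv : forall x, hom x (tens x one);
  tensm1 : forall x y, tensm (idm x) (idm y) = idm (tens x y);
  tensmM : forall x x' x'' y y' y'' (f' : hom x' x'') (f : hom x x')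
      (g' : hom y' y'') (g : hom y y'),
    tensm (f' ∘ f) (g' ∘ g) = tensm f' g' ∘ tensm f g;
  tensm_linearr : forall x x' y y' (f : hom x x'),
    linear (fun g : hom y y' => tensm f g);
  tensm_linearl : forall x x' y y' (g : hom y y'),
    linear (fun f : hom x x' => tensm f g);
  assocK : forall x y z, assoc_inv x y z ∘ assoc x y z = idm _;
  assoc_invK : forall x y z, assoc x y z ∘ assoc_inv x y z = idm _;
  lunitK : forall x, lunit_inv x ∘ lunit x = idm _;
  lunit_invK : forall x, lunit x ∘ lunit_inv x = idm _;
  runitK : forall x, runit_inv x ∘ runit x = idm _;
  runit_invK : forall x, runit x ∘ runit_inv x = idm _;
  assoc_natural : forall x x' y y' z z'
      (f : hom x x') (g : hom y y') (h : hom z z'),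
    assoc x' y' z' ∘ tensm (tensm f g) h = tensm f (tensm g h) ∘ assoc x y z;
  lunit_natural : forall x x' (f : hom x x'),
    lunit x' ∘ tensm (idm one) f = f ∘ lunit x;
  runit_natural : forall x x' (f : hom x x'),
    runit x' ∘ tensm f (idm one) = f ∘ runit x;
  pentagon : forall w x y z,
    assoc w x (tens y z) ∘ assoc (tens w x) y z
    = tensm (idm w) (assoc x y z) ∘ assoc w (tens x y) z
        ∘ tensm (assoc w x y) (idm z);
  triangle : forall x y,
    tensm (idm x) (lunit y) ∘ assoc x one y = tensm (runit x) (idm y)
}.

Arguments one {k m}.
Arguments tensm {k m x x' y y'} f g.
Notation "x ⊗ y" := (tens x y) : cat_scope.
Notation "f ⊗ₘ g" := (tensm f g) : cat_scope.

Section Rigid.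
Variables (k : fieldType) (C : monoidal_category k).

(* y is a left dual of x, and x a right dual of y. *)
Definition is_dual (x y : C) (ev : hom (y ⊗ x) one) (coev : hom one (x ⊗ y)) : Prop :=
  runit x ∘ (idm x ⊗ₘ ev) ∘ assoc x y x ∘ (coev ⊗ₘ idm x) = lunit x /\
  lunit y ∘ (ev ⊗ₘ idm y) ∘ assoc_inv y x y ∘ (idm y ⊗ₘ coev) = runit y.

Definition is_rigid : Prop := forall x : C,
  (exists y (ev : hom (y ⊗ x) one) coev, is_dual ev coev) /\
  (exists y (ev : hom (x ⊗ y) one) coev, is_dual ev coev).

End Rigid.

Record finite_tensor_category (k : fieldType) := FiniteTensorCategory {
  ftc_mon :> monoidal_category k;
  ftc_finite : is_finite_abelian ftc_mon;
  ftc_rigid : is_rigid ftc_mon;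
  ftc_end1 : bijective (fun a : k => a *: (idm one : hom (@one _ ftc_mon) one))
}.

(** * Lax, oplax, strong and Frobenius monoidal functors *)

Section MonoidalFunctors.
Variables (k : fieldType) (C D : monoidal_category k).

Record lax_data (G : linear_functor C D) := LaxData {
  lax2 : forall x y, hom (G x ⊗ G y) (G (x ⊗ y));
  lax0 : hom one (G one)
}.

Record oplax_data (G : linear_functor C D) := OplaxData {
  oplax2 : forall x y, hom (G (x ⊗ y)) (G x ⊗ G y);
  oplax0 : hom (G one) one
}.

Record is_lax (G : linear_functor C D) (m : lax_data G) : Prop := IsLax {
  lax_natural : forall x x' y y' (f : hom x x') (g : hom y y'),
    lax2 m x' y' ∘ (fmap G f ⊗ₘ fmap G g) = fmap G (f ⊗ₘ g) ∘ lax2 m x y;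
  lax_assoc : forall x y z,
    fmap G (assoc x y z) ∘ lax2 m (x ⊗ y) z ∘ (lax2 m x y ⊗ₘ idm (G z))
    = lax2 m x (y ⊗ z) ∘ (idm (G x) ⊗ₘ lax2 m y z) ∘ assoc (G x) (G y) (G z);
  lax_lunit : forall x,
    fmap G (lunit x) ∘ lax2 m one x ∘ (lax0 m ⊗ₘ idm (G x)) = lunit (G x);
  lax_runit : forall x,
    fmap G (runit x) ∘ lax2 m x one ∘ (idm (G x) ⊗ₘ lax0 m) = runit (G x)
}.

Record is_oplax (G : linear_functor C D) (w : oplax_data G) : Prop := IsOplax {
  oplax_natural : forall x x' y y' (f : hom x x') (g : hom y y'),
    oplax2 w x' y' ∘ fmap G (f ⊗ₘ g) = (fmap G f ⊗ₘ fmap G g) ∘ oplax2 w x y;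
  oplax_assoc : forall x y z,
    assoc (G x) (G y) (G z) ∘ (oplax2 w x y ⊗ₘ idm (G z)) ∘ oplax2 w (x ⊗ y) z
    = (idm (G x) ⊗ₘ oplax2 w y z) ∘ oplax2 w x (y ⊗ z) ∘ fmap G (assoc x y z);
  oplax_lunit : forall x,
    lunit (G x) ∘ (oplax0 w ⊗ₘ idm (G x)) ∘ oplax2 w one x = fmap G (lunit x);
  oplax_runit : forall x,
    runit (G x) ∘ (idm (G x) ⊗ₘ oplax0 w) ∘ oplax2 w x one = fmap G (runit x)
}.

(* The Frobenius relations of the strict case, with the associators inserted. *)
Record is_frobenius_monoidal (G : linear_functor C D)
    (m : lax_data G) (w : oplax_data G) : Prop := IsFrobeniusMonoidal {
  frob_lax : is_lax m;
  frob_oplax : is_oplax w;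
  frob_left : forall x y z,
    (idm (G x) ⊗ₘ lax2 m y z) ∘ assoc (G x) (G y) (G z)
      ∘ (oplax2 w x y ⊗ₘ idm (G z))
    = oplax2 w x (y ⊗ z) ∘ fmap G (assoc x y z) ∘ lax2 m (x ⊗ y) z;
  frob_right : forall x y z,
    (lax2 m x y ⊗ₘ idm (G z)) ∘ assoc_inv (G x) (G y) (G z)
      ∘ (idm (G x) ⊗ₘ oplax2 w y z)
    = oplax2 w (x ⊗ y) z ∘ fmap G (assoc_inv x y z) ∘ lax2 m x (y ⊗ z)
}.

Record is_strong (G : linear_functor C D) (m : lax_data G) (w : oplax_data G) :
    Prop := IsStrong {
  strong_lax : is_lax m;
  strong2K : forall x y, oplax2 w x y ∘ lax2 m x y = idm (G x ⊗ G y);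
  strong2_invK : forall x y, lax2 m x y ∘ oplax2 w x y = idm (G (x ⊗ y));
  strong0K : oplax0 w ∘ lax0 m = idm one;
  strong0_invK : lax0 m ∘ oplax0 w = idm (G one)
}.

(* The inverses of the monoidal constraints are part of the data. *)
Record tensor_functor := TensorFunctor {
  tf_fun :> linear_functor C D;
  tf_lax : lax_data tf_fun;
  tf_inv : oplax_data tf_fun;
  tf_strong : is_strong tf_lax tf_inv;
  tf_exact : is_exact tf_fun
}.

End MonoidalFunctors.

Section InducedStructures.
Variables (k : fieldType) (C D : monoidal_category k) (F : tensor_functor C D).

Definition right_adjoint_lax (R : linear_functor D C) (a : adjunction F R) :
    lax_data R :=
  LaxData
    (fun d d' =>
       fmap R ((adj_counit a d ⊗ₘ adj_counit a d') ∘ oplax2 (tf_inv F) (R d) (R d'))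
         ∘ adj_unit a (R d ⊗ R d'))
    (fmap R (oplax0 (tf_inv F)) ∘ adj_unit a one).

Definition left_adjoint_oplax (L : linear_functor D C) (a : adjunction L F) :
    oplax_data L :=
  OplaxData
    (fun d d' =>
       adj_counit a (L d ⊗ L d')
         ∘ fmap L (lax2 (tf_lax F) (L d) (L d') ∘ (adj_unit a d ⊗ₘ adj_unit a d')))
    (adj_counit a one ∘ fmap L (lax0 (tf_lax F))).

End InducedStructures.

(* The result depends on phi: for F = Id on graded vector spaces, rescaling the
   identity by scalars that do not form a character (up to a constant) breaks
   the Frobenius relations with the canonical lax structure. *)
Definition transport_oplax (k : fieldType) (D C : monoidal_category k)
    (L R : linear_functor D C) (phi : nat_iso L R) (w : oplax_data L) :
    oplax_data R :=
  OplaxData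
    (fun d d' => (phi d ⊗ₘ phi d') ∘ oplax2 w d d' ∘ nat_inv phi (d ⊗ d'))
    (oplax0 w ∘ nat_inv phi one).

(* Main.v *)
(** Let e : R 1 -> 1 be such that f |-> e ∘ R f is a bijection from Hom(d, 1)
    to Hom(R d, 1) for all d (a Frobenius form).  Such an e exists when R is also
    left adjoint to F (take the counit at 1), for an arbitrary such adjunction,
    and also when R is Frobenius monoidal (take its oplax unit).  Conversely, since
    C is rigid the projection maps c ⊗ R d -> R (F c ⊗ d) are invertible, and e
    yields a new adjunction R -| F with counit
    R (F c) ≅ c ⊗ R 1 -> c ⊗ 1 ≅ c: a map R d -> c is the same as a map
    R (F c* ⊗ d) ≅ c* ⊗ R d -> 1, hence the same as F c* ⊗ d -> 1 and as d -> F c.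

    By construction this adjunction is one of left C-module functors, which gives
    one Frobenius relation.  The other one need not come from compatibility with
    the right C-action; it follows from the first, because the pairing
    R x* ⊗ R x -> R (x* ⊗ x) -> R 1 -> 1 is nondegenerate: maps into R x ⊗ z can be
    compared after pairing with R x*, where the first relation turns the oplax
    structure into the lax one.  Finally an arbitrary left adjoint L is identified
    with R by uniqueness of adjoints. *)

From HB Require Import structures.
From mathcomp Require Import all_boot all_algebra.
Require Import Defs.

Set Implicit Arguments.
Unset Strict Implicit.
Unset Printing Implicit Defensive.

(** * Monoidal coherence and duals *)

Section Composition.
Variables (k : fieldType) (C : linear_category k).

(** Composites are kept associated to the left; [comp2], [comp3] and [comp4] rewrite with an
    equation whose left side sits below a further factor [t]. *)
Lemma comp2 (w x y z : C) (g : hom x y) (f : hom w x) h (t : hom y z) :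
  g ∘ f = h -> t ∘ g ∘ f = t ∘ h.
Proof. by move=> <-; rewrite compA. Qed.

Lemma comp3 (v w x y z : C) (g : hom x y) (f : hom w x) (e : hom v w) h
    (t : hom y z) :
  g ∘ f ∘ e = h -> t ∘ g ∘ f ∘ e = t ∘ h.
Proof. by move=> <-; rewrite !compA. Qed.

Lemma comp4 (u v w x y z : C) (g : hom x y) (f : hom w x) (e : hom v w)
    (d : hom u v) h (t : hom y z) :
  g ∘ f ∘ e ∘ d = h -> t ∘ g ∘ f ∘ e ∘ d = t ∘ h.
Proof. by move=> <-; rewrite !compA. Qed.

Lemma split_epi_cancel (x y z : C) (p : hom x y) (s : hom y x) (u v : hom y z) :
  p ∘ s = idm y -> u ∘ p = v ∘ p -> u = v.
Proof.
by move=> ps e; rewrite -(compm1 u) -(compm1 v) -ps !compA e.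
Qed.

Lemma split_mono_cancel (x y z : C) (i : hom y z) (r : hom z y) (u v : hom x y) :
  r ∘ i = idm y -> i ∘ u = i ∘ v -> u = v.
Proof.
by move=> ri e; rewrite -(comp1m u) -(comp1m v) -ri -!compA e.
Qed.

End Composition.

Section Monoidal.
Variables (k : fieldType) (C : monoidal_category k).
Implicit Types w x y z : C.

Lemma tensml x x' x'' y (f : hom x' x'') (g : hom x x') :
  (f ∘ g) ⊗ₘ idm y = (f ⊗ₘ idm y) ∘ (g ⊗ₘ idm y).
Proof. by rewrite -tensmM comp1m. Qed.

Lemma tensmr x y y' y'' (f : hom y' y'') (g : hom y y') :
  idm x ⊗ₘ (f ∘ g) = (idm x ⊗ₘ f) ∘ (idm x ⊗ₘ g).
Proof. by rewrite -tensmM comp1m. Qed.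

Lemma tensm_lr x x' y y' (f : hom x x') (g : hom y y') :
  (f ⊗ₘ idm y') ∘ (idm x ⊗ₘ g) = f ⊗ₘ g.
Proof. by rewrite -tensmM comp1m compm1. Qed.

Lemma tensm_rl x x' y y' (f : hom x x') (g : hom y y') :
  (idm x' ⊗ₘ g) ∘ (f ⊗ₘ idm y) = f ⊗ₘ g.
Proof. by rewrite -tensmM comp1m compm1. Qed.

Lemma interchange x x' y y' (f : hom x x') (g : hom y y') :
  (f ⊗ₘ idm y') ∘ (idm x ⊗ₘ g) = (idm x' ⊗ₘ g) ∘ (f ⊗ₘ idm y).
Proof. by rewrite tensm_lr tensm_rl. Qed.

Lemma assoc_inv_natural x x' y y' z z' (f : hom x x') (g : hom y y') (h : hom z z') :
  assoc_inv x' y' z' ∘ (f ⊗ₘ (g ⊗ₘ h)) = ((f ⊗ₘ g) ⊗ₘ h) ∘ assoc_inv x y z.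
Proof.
apply: (split_epi_cancel (assoc_invK x y z)).
by rewrite (comp2 _ (assocK x y z)) compm1 -compA -assoc_natural compA assocK comp1m.
Qed.

Lemma lunit_inv_natural x x' (f : hom x x') :
  lunit_inv x' ∘ f = (idm one ⊗ₘ f) ∘ lunit_inv x.
Proof.
apply: (split_mono_cancel (lunitK x')).
by rewrite !compA lunit_invK lunit_natural comp1m (comp2 _ (lunit_invK x)) compm1.
Qed.

Lemma tens1_inj x y (f g : hom x y) : idm one ⊗ₘ f = idm one ⊗ₘ g -> f = g.
Proof.
by move=> e; apply: (split_epi_cancel (lunit_invK x)); rewrite -!lunit_natural e.
Qed.

Lemma tens_one_inj x y (f g : hom x y) : f ⊗ₘ idm one = g ⊗ₘ idm one -> f = g.
Proof.
by move=> e; apply: (split_epi_cancel (runit_invK x)); rewrite -!runit_natural e.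
Qed.

Lemma triangle_inv x y :
  assoc x one y ∘ (runit_inv x ⊗ₘ idm y) = idm x ⊗ₘ lunit_inv y.
Proof.
have lK : (idm x ⊗ₘ lunit_inv y) ∘ (idm x ⊗ₘ lunit y) = idm _.
  by rewrite -tensmr lunitK tensm1.
apply: (split_mono_cancel lK).
by rewrite compA triangle -tensml -tensmr runit_invK lunit_invK !tensm1.
Qed.

(** Kelly's argument: tensoring with [one] on the left is injective on maps, and after
    precomposition with invertible associators the pentagon and the triangle apply. *)
Lemma lunit_tens x y : lunit (x ⊗ y) ∘ assoc one x y = lunit x ⊗ₘ idm y.
Proof.
apply: tens1_inj; rewrite tensmr.
have aK : assoc one (one ⊗ x) y ∘ (assoc one one x ⊗ₘ idm y)
   ∘ ((assoc_inv one one x ⊗ₘ idm y) ∘ assoc_inv one (one ⊗ x) y) = idm _.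
  rewrite compA (comp2 _ (esym (tensml _ _ _))) assoc_invK tensm1 compm1.
  exact: assoc_invK.
apply: (split_epi_cancel aK); rewrite !compA.
rewrite (comp3 _ (esym (pentagon _ _ _ _))) compA triangle.
rewrite -assoc_natural -(tensm1 x y) -(assoc_natural (runit one)).
by rewrite (comp2 _ (esym (tensml _ _ _))) triangle.
Qed.

Lemma runit_tens x y : (idm x ⊗ₘ runit y) ∘ assoc x y one = runit (x ⊗ y).
Proof.
apply: tens_one_inj; rewrite tensml.
apply: (split_mono_cancel (assocK x y one)).
rewrite -(triangle (x ⊗ y) one) !compA assoc_natural.
rewrite -(triangle y one) tensmr -[in RHS](tensm1 x y) assoc_natural.
rewrite (comp2 _ (pentagon _ _ _ _)).
by rewrite !compA.
Qed.

(** Naturality of [lunit] at the isomorphism [lunit one] identifies [lunit (one ⊗ one)] with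
    [idm one ⊗ₘ lunit one]; [lunit_tens] and the triangle then compare the two unitors after
    tensoring with [one]. *)
Lemma lunit_one : lunit one = runit one :> hom (@one _ C ⊗ one) one.
Proof.
apply: tens_one_inj; rewrite -triangle -lunit_tens.
suff -> : lunit (@one _ C ⊗ one) = idm one ⊗ₘ lunit one by [].
apply: (split_mono_cancel (lunitK one)).
by rewrite lunit_natural.
Qed.

Lemma assoc_inv_l x y z w (f : hom w x) :
  assoc_inv x y z ∘ (f ⊗ₘ idm (y ⊗ z)) = ((f ⊗ₘ idm y) ⊗ₘ idm z) ∘ assoc_inv w y z.
Proof. by rewrite -assoc_inv_natural tensm1. Qed.

Lemma assoc_r x y z w (f : hom w z) :
  assoc x y z ∘ (idm (x ⊗ y) ⊗ₘ f) = (idm x ⊗ₘ (idm y ⊗ₘ f)) ∘ assoc x y w.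
Proof. by rewrite -assoc_natural tensm1. Qed.

Lemma assoc_l x y z w (f : hom w x) :
  assoc x y z ∘ ((f ⊗ₘ idm y) ⊗ₘ idm z) = (f ⊗ₘ idm (y ⊗ z)) ∘ assoc w y z.
Proof. by rewrite assoc_natural tensm1. Qed.

Lemma assoc_inv_r x y z w (f : hom w z) :
  assoc_inv x y z ∘ (idm x ⊗ₘ (idm y ⊗ₘ f)) = (idm (x ⊗ y) ⊗ₘ f) ∘ assoc_inv x y w.
Proof. by rewrite assoc_inv_natural tensm1. Qed.

Lemma pentagon_l w x y z :
  (idm w ⊗ₘ assoc_inv x y z) ∘ assoc w x (y ⊗ z)
  = assoc w (x ⊗ y) z ∘ (assoc w x y ⊗ₘ idm z) ∘ assoc_inv (w ⊗ x) y z.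
Proof.
apply: (split_epi_cancel (assoc_invK (w ⊗ x) y z)).
rewrite (comp2 _ (assocK _ _ _)) compm1 (comp2 _ (pentagon _ _ _ _)) !compA.
by rewrite -tensmr assocK tensm1 comp1m.
Qed.

Lemma pentagon_r w x y z :
  assoc_inv w x (y ⊗ z) ∘ (idm w ⊗ₘ assoc x y z)
  = assoc (w ⊗ x) y z ∘ (assoc_inv w x y ⊗ₘ idm z) ∘ assoc_inv w (x ⊗ y) z.
Proof.
apply: (split_mono_cancel (assocK w x (y ⊗ z))).
rewrite !compA assoc_invK comp1m pentagon.
rewrite (comp2 _ (esym (tensml _ _ _))) assoc_invK tensm1 compm1.
by rewrite (comp2 _ (assoc_invK _ _ _)) compm1.
Qed.

End Monoidal.

(* Locked so that [compA] and [tensmr] do not rewrite inside [act] and [coact]. *)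
HB.lock Definition act (k : fieldType) (C : monoidal_category k) (y x : C)
    (p : hom (y ⊗ x) one) (z : C) : hom (y ⊗ (x ⊗ z)) z :=
  lunit z ∘ (p ⊗ₘ idm z) ∘ assoc_inv y x z.

HB.lock Definition coact (k : fieldType) (C : monoidal_category k) (x y : C)
    (q : hom one (x ⊗ y)) (z : C) : hom z (x ⊗ (y ⊗ z)) :=
  assoc x y z ∘ (q ⊗ₘ idm z) ∘ lunit_inv z.

(** * Duality as an adjunction between tensoring functors *)

Section Actions.
Variables (k : fieldType) (C : monoidal_category k).
Implicit Types w x y z : C.

Lemma act_natural y x (p : hom (y ⊗ x) one) z z' (f : hom z z') :
  act p z' ∘ (idm y ⊗ₘ (idm x ⊗ₘ f)) = f ∘ act p z.
Proof.
rewrite !act.unlock (comp2 _ (assoc_inv_r _ _ _)) !compA (comp2 _ (interchange _ _)).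
by rewrite !compA lunit_natural.
Qed.

Lemma act_dom y y' x (p : hom (y ⊗ x) one) (g : hom y' y) z :
  act p z ∘ (g ⊗ₘ idm (x ⊗ z)) = act (p ∘ (g ⊗ₘ idm x)) z.
Proof.
by rewrite !act.unlock (comp2 _ (assoc_inv_l _ _ _)) !compA tensml !compA.
Qed.

Lemma act_tens y x (p : hom (y ⊗ x) one) z z' :
  act p (z ⊗ z') ∘ (idm y ⊗ₘ assoc x z z')
  = (act p z ⊗ₘ idm z') ∘ assoc_inv y (x ⊗ z) z'.
Proof.
rewrite !act.unlock (comp2 _ (pentagon_r _ _ _ _)) !compA (comp2 _ (esym (assoc_l _ _ _))).
by rewrite !compA lunit_tens !tensml.
Qed.

Lemma coact_natural x y (q : hom one (x ⊗ y)) z z' (f : hom z z') :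
  coact q z' ∘ f = (idm x ⊗ₘ (idm y ⊗ₘ f)) ∘ coact q z.
Proof.
rewrite !coact.unlock (comp2 _ (lunit_inv_natural _)) !compA (comp2 _ (interchange _ _)).
by rewrite !compA assoc_r.
Qed.

Section Dual.
Variables (x y : C) (ev : hom (y ⊗ x) one) (coev : hom one (x ⊗ y)).
Hypothesis dual : is_dual ev coev.

(** With [actK], these are the triangle identities for [y ⊗ -] left adjoint to [x ⊗ -], with unit
    [coact coev] and counit [act ev]; this one is the first snake identity tensored with [z]. *)
Lemma coactK z : (idm x ⊗ₘ act ev z) ∘ coact coev (x ⊗ z) = idm _.
Proof.
rewrite !coact.unlock !act.unlock !tensmr !compA (comp2 _ (pentagon_l _ _ _ _)) !compA.
rewrite (comp2 _ (esym (assoc_natural _ _ _))) !compA triangle.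
rewrite (comp2 _ (assoc_inv_l _ _ _)) !compA -!tensml.
rewrite dual.1 -lunit_tens (comp2 _ (assoc_invK _ _ _)) compm1.
exact: lunit_invK.
Qed.

Lemma act_coev : act ev y ∘ (idm y ⊗ₘ coev) = runit y.
Proof. by rewrite act.unlock dual.2. Qed.

Lemma actK z : act ev (y ⊗ z) ∘ (idm y ⊗ₘ coact coev z) = idm _.
Proof.
rewrite !coact.unlock !tensmr !compA act_tens (comp2 _ (assoc_inv_natural _ _ _)) !compA.
rewrite -tensml act_coev -triangle (comp2 _ (assoc_invK _ _ _)) compm1.
by rewrite -tensmr lunit_invK tensm1.
Qed.

Lemma ev_runit : ev ∘ (idm y ⊗ₘ runit x) = act ev one.
Proof.
rewrite !act.unlock lunit_one runit_natural -runit_tens -!compA.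
by rewrite assoc_invK compm1.
Qed.

Lemma dual_transpose z (h : hom (y ⊗ z) one) :
  exists f : hom z x, ev ∘ (idm y ⊗ₘ f) = h.
Proof.
exists (runit x ∘ (idm x ⊗ₘ h) ∘ coact coev z).
by rewrite !tensmr !compA ev_runit act_natural -compA actK compm1.
Qed.

Lemma dual_transpose_inj z (f g : hom z x) :
  ev ∘ (idm y ⊗ₘ f) = ev ∘ (idm y ⊗ₘ g) -> f = g.
Proof.
have E (t : hom z x) :
    runit x ∘ (idm x ⊗ₘ (ev ∘ (idm y ⊗ₘ t))) ∘ coact coev z = t.
  rewrite tensmr !compA (comp2 _ (esym (coact_natural _ _))) coact.unlock !compA.
  by rewrite dual.1 lunit_invK comp1m.
by move=> fg; rewrite -(E f) fg E.
Qed.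

(** The witness inserts [coev] to the right of [z] and applies [h]; the first snake identity,
    tensored with [z] on the left, undoes the insertion. *)
Lemma dual_transpose_left z (h : hom (z ⊗ x) one) :
  exists g : hom z y, ev ∘ (g ⊗ₘ idm x) = h.
Proof.
exists (lunit y ∘ (h ⊗ₘ idm y) ∘ assoc_inv z x y ∘ (idm z ⊗ₘ coev) ∘ runit_inv z).
rewrite !tensml !compA -lunit_tens compA -lunit_natural.
rewrite (comp2 _ (assoc_l _ _ _)) !compA (comp2 _ (esym (interchange _ _))) !compA.
rewrite lunit_one runit_natural -runit_tens.
rewrite !compA (comp2 _ (assoc_r _ _ _)) !compA (comp2 _ (pentagon _ _ _ _)) !compA.
rewrite (comp2 _ (esym (tensml _ (assoc _ _ _) (assoc_inv _ _ _)))) assoc_invK tensm1 compm1.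
rewrite (comp2 _ (assoc_natural _ _ _)) !compA.
have snake := congr1 (fun t => idm z ⊗ₘ t) dual.1; rewrite /= !tensmr in snake.
rewrite (comp4 _ snake) (comp2 _ (triangle_inv _ _)) -!compA -tensmr.
by rewrite lunit_invK tensm1 compm1.
Qed.

(** A map into [x ⊗ z] is recovered from its pairing with [y] by the triangle identity [coactK]. *)
Lemma act_detects w z (u v : hom w (x ⊗ z)) :
  act ev z ∘ (idm y ⊗ₘ u) = act ev z ∘ (idm y ⊗ₘ v) -> u = v.
Proof.
have E (t : hom w (x ⊗ z)) :
    (idm x ⊗ₘ (act ev z ∘ (idm y ⊗ₘ t))) ∘ coact coev w = t.
  by rewrite tensmr (comp2 _ (esym (coact_natural _ _))) !compA coactK comp1m.
by move=> uv; rewrite -(E u) uv E.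
Qed.

End Dual.
End Actions.

(** * Adjunctions *)

Section Transpose.
Variables (k : fieldType) (C D : linear_category k).
Variables (F : linear_functor C D) (R : linear_functor D C) (a : adjunction F R).

Lemma adj_mates c d (f : hom (F c) d) :
  adj_counit a d ∘ fmap F (fmap R f ∘ adj_unit a c) = f.
Proof. by rewrite fmapM compA adj_counit_natural -compA adj_triangle_left compm1. Qed.

Lemma adj_mates' c d (g : hom c (R d)) :
  fmap R (adj_counit a d ∘ fmap F g) ∘ adj_unit a c = g.
Proof. by rewrite fmapM -compA -adj_unit_natural compA adj_triangle_right comp1m. Qed.

Lemma adj_inj c d (u v : hom c (R d)) :
  adj_counit a d ∘ fmap F u = adj_counit a d ∘ fmap F v -> u = v.
Proof. by move=> uv; rewrite -(adj_mates' u) uv adj_mates'. Qed.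

Lemma adj_unit_inj c d (u v : hom (F c) d) :
  fmap R u ∘ adj_unit a c = fmap R v ∘ adj_unit a c -> u = v.
Proof. by move=> uv; rewrite -(adj_mates u) uv adj_mates. Qed.

End Transpose.

(** * Adjunctions from universal arrows *)

Section Universal.
Variables (k : fieldType) (C D : linear_category k).
Variables (G : linear_functor D C) (F : linear_functor C D).
Variable eps : forall c, hom (G (F c)) c.
Hypothesis eps_natural : forall c c' (f : hom c c'),
  eps c' ∘ fmap G (fmap F f) = f ∘ eps c.
Hypothesis eps_surj : forall d c (h : hom (G d) c),
  exists f : hom d (F c), eps c ∘ fmap G f == h.
Hypothesis eps_inj : forall d c (f g : hom d (F c)),
  eps c ∘ fmap G f = eps c ∘ fmap G g -> f = g.

(** The unit is data, while [eps_surj] only asserts existence; stating that hypothesis with [==]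
    lets [xchoose] extract a preimage of the identity. *)
Let eta d : hom d (F (G d)) := xchoose (eps_surj (idm (G d))).

Let etaP d : eps (G d) ∘ fmap G (eta d) = idm (G d).
Proof. exact/eqP/(xchooseP (eps_surj (idm (G d)))). Qed.

Let eta_natural d d' (f : hom d d') : eta d' ∘ f = fmap F (fmap G f) ∘ eta d.
Proof.
apply: eps_inj; rewrite !fmapM !compA etaP comp1m eps_natural.
by rewrite -compA etaP compm1.
Qed.

Let eps_eta c : fmap F (eps c) ∘ eta (F c) = idm (F c).
Proof.
apply: eps_inj; rewrite fmapM compA eps_natural -compA etaP compm1.
by rewrite fmap1 compm1.
Qed.

Definition adjunction_of_universal : adjunction G F :=
  Adjunction eta_natural eps_natural etaP eps_eta.

End Universal.

Section NatIso.
Variables (k : fieldType) (C D : linear_category k).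

Lemma nat_iso_inv_natural (G H : linear_functor C D) (phi : nat_iso G H)
    x y (f : hom x y) :
  nat_inv phi y ∘ fmap H f = fmap G f ∘ nat_inv phi x.
Proof.
apply: (split_epi_cancel (nat_funK phi x)).
rewrite (comp2 _ (esym (nat_natural phi f))) !compA nat_invK comp1m.
by rewrite (comp2 _ (nat_invK phi x)) compm1.
Qed.

Lemma nat_iso_refl (G : linear_functor C D) : nat_iso G G.
Proof.
by exists (fun x => idm (G x)) (fun x => idm (G x)) => [x|x|x y f];
  rewrite ?comp1m ?compm1.
Qed.

Definition nat_iso_sym (G H : linear_functor C D) (phi : nat_iso G H) :
  nat_iso H G := NatIso (nat_funK phi) (nat_invK phi) (nat_iso_inv_natural phi).

Lemma nat_iso_trans (G H K : linear_functor C D) :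
  nat_iso G H -> nat_iso H K -> nat_iso G K.
Proof.
move=> phi psi.
exists (fun x => psi x ∘ phi x) (fun x => nat_inv phi x ∘ nat_inv psi x).
- by move=> x; rewrite !compA (comp2 _ (nat_invK psi x)) compm1 nat_invK.
- by move=> x; rewrite !compA (comp2 _ (nat_funK phi x)) compm1 nat_funK.
- move=> x y f; rewrite (comp2 _ (nat_natural phi f)) !compA.
  by rewrite (nat_natural psi).
Qed.

End NatIso.

(** * Uniqueness of adjoints *)

Section RightAdjoints.
Variables (k : fieldType) (C D : linear_category k) (F : linear_functor C D).

Definition right_adjoint_map (R R' : linear_functor D C) (a : adjunction F R)
    (a' : adjunction F R') d : hom (R d) (R' d) :=
  fmap R' (adj_counit a d) ∘ adj_unit a' (R d).

Lemma right_adjoint_map_natural (R R' : linear_functor D C) (a : adjunction F R)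
    (a' : adjunction F R') d d' (f : hom d d') :
  right_adjoint_map a a' d' ∘ fmap R f = fmap R' f ∘ right_adjoint_map a a' d.
Proof.
rewrite /right_adjoint_map -compA adj_unit_natural !compA -!fmapM.
by rewrite adj_counit_natural.
Qed.

Lemma right_adjoint_mapK (R R' : linear_functor D C) (a : adjunction F R)
    (a' : adjunction F R') d :
  right_adjoint_map a' a d ∘ right_adjoint_map a a' d = idm (R d).
Proof.
apply: (adj_inj (a := a)); rewrite fmapM compA /right_adjoint_map !adj_mates.
by rewrite fmap1 compm1.
Qed.

Definition right_adjoint_iso (R R' : linear_functor D C) (a : adjunction F R)
    (a' : adjunction F R') : nat_iso R R' :=
  NatIso (right_adjoint_mapK a a') (right_adjoint_mapK a' a)
    (right_adjoint_map_natural a a').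

End RightAdjoints.

Section LeftAdjoints.
Variables (k : fieldType) (C D : linear_category k).
Variables (F : linear_functor C D) (L L' : linear_functor D C).
Variables (a : adjunction L F) (a' : adjunction L' F).

Definition left_adjoint_map d : hom (L d) (L' d) :=
  adj_counit a (L' d) ∘ fmap L (adj_unit a' d).

Lemma left_adjoint_map_natural d d' (f : hom d d') :
  left_adjoint_map d' ∘ fmap L f = fmap L' f ∘ left_adjoint_map d.
Proof.
rewrite /left_adjoint_map compA -adj_counit_natural -!compA -!fmapM.
by rewrite adj_unit_natural.
Qed.

(** This equation determines the comparison map, since maps out of [L d] are detected on the unit of
    [a]. *)
Lemma left_adjoint_map_unit d :
  fmap F (left_adjoint_map d) ∘ adj_unit a d = adj_unit a' d.
Proof. by rewrite /left_adjoint_map adj_mates'. Qed.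

End LeftAdjoints.

Section LeftAdjointIso.
Variables (k : fieldType) (C D : linear_category k).
Variables (F : linear_functor C D) (L L' : linear_functor D C).
Variables (a : adjunction L F) (a' : adjunction L' F).

Lemma left_adjoint_mapK (M M' : linear_functor D C) (b : adjunction M F)
    (b' : adjunction M' F) d :
  left_adjoint_map b' b d ∘ left_adjoint_map b b' d = idm (M d).
Proof.
apply: (adj_unit_inj (a := b)).
by rewrite fmapM -compA !left_adjoint_map_unit fmap1 comp1m.
Qed.

Definition left_adjoint_iso : nat_iso L L' :=
  NatIso (left_adjoint_mapK a a') (left_adjoint_mapK a' a)
    (left_adjoint_map_natural a a').

End LeftAdjointIso.

(** * Monoidal structures on adjoints of strong functors *)

Section LaxNaturality.
Variables (k : fieldType) (C D : monoidal_category k) (G : linear_functor C D).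

Lemma lax_natural_l (m : lax_data G) (lm : is_lax m) x x' y (f : hom x x') :
  lax2 m x' y ∘ (fmap G f ⊗ₘ idm (G y)) = fmap G (f ⊗ₘ idm y) ∘ lax2 m x y.
Proof. by rewrite -(fmap1 G) (lax_natural lm). Qed.

Lemma lax_natural_r (m : lax_data G) (lm : is_lax m) x y y' (f : hom y y') :
  lax2 m x y' ∘ (idm (G x) ⊗ₘ fmap G f) = fmap G (idm x ⊗ₘ f) ∘ lax2 m x y.
Proof. by rewrite -(fmap1 G) (lax_natural lm). Qed.

Lemma oplax_natural_l (w : oplax_data G) (ow : is_oplax w) x x' y (f : hom x x') :
  oplax2 w x' y ∘ fmap G (f ⊗ₘ idm y) = (fmap G f ⊗ₘ idm (G y)) ∘ oplax2 w x y.
Proof. by rewrite -(fmap1 G) (oplax_natural ow). Qed.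

Lemma oplax_natural_r (w : oplax_data G) (ow : is_oplax w) x y y' (f : hom y y') :
  oplax2 w x y' ∘ fmap G (idm x ⊗ₘ f) = (idm (G x) ⊗ₘ fmap G f) ∘ oplax2 w x y.
Proof. by rewrite -(fmap1 G) (oplax_natural ow). Qed.

Lemma lax_assoc_inv (m : lax_data G) (lm : is_lax m) x y z :
  fmap G (assoc_inv x y z) ∘ lax2 m x (y ⊗ z) ∘ (idm (G x) ⊗ₘ lax2 m y z)
  = lax2 m (x ⊗ y) z ∘ (lax2 m x y ⊗ₘ idm (G z)) ∘ assoc_inv (G x) (G y) (G z).
Proof.
apply: (split_epi_cancel (assoc_invK (G x) (G y) (G z))).
rewrite (comp3 _ (esym (lax_assoc lm _ _ _))) !compA -fmapM assocK fmap1 comp1m.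
by rewrite (comp2 _ (assocK _ _ _)) compm1.
Qed.

End LaxNaturality.

Section StrongFunctors.
Variables (k : fieldType) (C D : monoidal_category k) (F : tensor_functor C D).

Local Notation F2 := (lax2 (tf_lax F)).
Local Notation F2i := (oplax2 (tf_inv F)).
Local Notation F0 := (lax0 (tf_lax F)).
Local Notation F0i := (oplax0 (tf_inv F)).

Let sF := tf_strong F.
Let lF := strong_lax sF.

Lemma F2K x y : F2i x y ∘ F2 x y = idm _. Proof. exact: strong2K sF x y. Qed.
Lemma F2iK x y : F2 x y ∘ F2i x y = idm _. Proof. exact: strong2_invK sF x y. Qed.
Lemma F0K : F0i ∘ F0 = idm _. Proof. exact: strong0K sF. Qed.
Lemma F0iK : F0 ∘ F0i = idm _. Proof. exact: strong0_invK sF. Qed.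

(** Each oplax axiom is the matching lax axiom with its constraints moved to the other side:
    precomposing with an invertible composite of [F2] and [F0] cancels the inverses. *)
Lemma tensor_functor_oplax : is_oplax (tf_inv F).
Proof.
split.
- move=> x x' y y' f g; apply: (split_epi_cancel (F2iK x y)).
  rewrite (comp2 _ (esym (lax_natural lF _ _))) !compA F2K comp1m.
  by rewrite (comp2 _ (F2K _ _)) compm1.
- move=> x y z.
  have K : F2 (x ⊗ y) z ∘ (F2 x y ⊗ₘ idm (F z))
     ∘ ((F2i x y ⊗ₘ idm (F z)) ∘ F2i (x ⊗ y) z) = idm _.
    rewrite compA (comp2 _ (esym (tensml _ _ _))) F2iK tensm1 compm1.
    exact: F2iK.
  apply: (split_epi_cancel K); rewrite !compA.
  rewrite (comp2 _ (F2K _ _)) compm1 (comp2 _ (esym (tensml _ _ _))) F2K tensm1.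
  rewrite compm1 (comp3 _ (lax_assoc lF _ _ _)) !compA (comp2 _ (F2K _ _)) compm1.
  by rewrite -tensmr F2K tensm1 comp1m.
- move=> x.
  have K : F2 one x ∘ (F0 ⊗ₘ idm (F x)) ∘ ((F0i ⊗ₘ idm (F x)) ∘ F2i one x) = idm _.
    rewrite compA (comp2 _ (esym (tensml _ _ _))) F0iK tensm1 compm1.
    exact: F2iK.
  apply: (split_epi_cancel K); rewrite !compA (lax_lunit lF).
  rewrite (comp2 _ (F2K _ _)) compm1 (comp2 _ (esym (tensml _ _ _))) F0K tensm1.
  by rewrite compm1.
- move=> x.
  have K : F2 x one ∘ (idm (F x) ⊗ₘ F0) ∘ ((idm (F x) ⊗ₘ F0i) ∘ F2i x one) = idm _.
    rewrite compA (comp2 _ (esym (tensmr _ _ _))) F0iK tensm1 compm1.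
    exact: F2iK.
  apply: (split_epi_cancel K); rewrite !compA (lax_runit lF).
  rewrite (comp2 _ (F2K _ _)) compm1 (comp2 _ (esym (tensmr _ _ _))) F0K tensm1.
  by rewrite compm1.
Qed.

Let oF := tensor_functor_oplax.

Definition image_ev x y (ev : hom (y ⊗ x) one) : hom (F y ⊗ F x) one :=
  F0i ∘ fmap F ev ∘ F2 y x.

Definition image_coev x y (coev : hom one (x ⊗ y)) : hom one (F x ⊗ F y) :=
  F2i x y ∘ fmap F coev ∘ F0.

(** In each half, [K] is a Frobenius-type relation between [F2] and [F2i], valid because they are
    inverse. It moves the constraints past the associator, and naturality then leaves [F] of the
    original snake. *)
Lemma image_dual x y (ev : hom (y ⊗ x) one) (coev : hom one (x ⊗ y)) :
  is_dual ev coev -> is_dual (image_ev ev) (image_coev coev).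
Proof.
rewrite /image_ev /image_coev => dual; split.
- rewrite !tensmr !tensml !compA.
  have K : assoc (F x) (F y) (F x) ∘ (F2i x y ⊗ₘ idm (F x))
      = (idm (F x) ⊗ₘ F2i y x) ∘ F2i x (y ⊗ x) ∘ fmap F (assoc x y x) ∘ F2 (x ⊗ y) x.
    by rewrite -(oplax_assoc oF) -compA F2K compm1.
  rewrite (comp2 _ K) !compA (comp2 _ (esym (tensmr _ _ _))) F2iK tensm1 compm1.
  rewrite (comp2 _ (esym (oplax_natural_r oF _ _))) !compA (oplax_runit oF).
  by rewrite (comp2 _ (lax_natural_l lF _ _)) !compA -!fmapM dual.1 (lax_lunit lF).
- rewrite !tensmr !tensml !compA.
  have K : (F2 y x ⊗ₘ idm (F y)) ∘ assoc_inv (F y) (F x) (F y)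
      ∘ (idm (F y) ⊗ₘ F2i x y)
      = F2i (y ⊗ x) y ∘ fmap F (assoc_inv y x y) ∘ F2 y (x ⊗ y).
    apply: (split_mono_cancel (F2K _ _)); rewrite !compA F2iK comp1m.
    have aK : fmap F (assoc_inv y x y) ∘ fmap F (assoc y x y) = idm _.
      by rewrite -fmapM assocK fmap1.
    have aK' : fmap F (assoc y x y) ∘ fmap F (assoc_inv y x y) = idm _.
      by rewrite -fmapM assoc_invK fmap1.
    apply: (split_mono_cancel aK); rewrite !compA aK' comp1m (lax_assoc lF).
    by rewrite (comp2 _ (assoc_invK _ _ _)) compm1 (comp2 _ (esym (tensmr _ _ _)))
         F2iK tensm1 compm1.
  rewrite (comp3 _ K) !compA.
  rewrite (comp2 _ (esym (oplax_natural_l oF _ _))) !compA (oplax_lunit oF).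
  by rewrite (comp2 _ (lax_natural_r lF _ _)) !compA -!fmapM dual.2 (lax_runit lF).
Qed.

Section LeftAdjoint.
Variables (L : linear_functor D C) (a : adjunction L F) (w : oplax_data L).
Local Notation eta := (adj_unit a).
Hypothesis w2_unit : forall x y,
  fmap F (oplax2 w x y) ∘ eta (x ⊗ y) = F2 (L x) (L y) ∘ (eta x ⊗ₘ eta y).
Hypothesis w0_unit : fmap F (oplax0 w) ∘ eta one = F0.

(** Tested on the unit, each oplax axiom becomes a lax axiom of [F]. Only the two unit equations on
    [w] enter, so that the lemma also covers structures transported along an isomorphism. *)
Lemma left_adjoint_oplaxP : is_oplax w.
Proof.
split.
- move=> x x' y y' f g; apply: (adj_unit_inj (a := a)); rewrite !fmapM.
  rewrite -compA -adj_unit_natural compA w2_unit (comp2 _ (w2_unit _ _)) !compA.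
  rewrite -(lax_natural lF) -!compA -!tensmM.
  by rewrite !adj_unit_natural.
- move=> x y z; apply: (adj_unit_inj (a := a)); rewrite !fmapM.
  rewrite (comp2 _ (w2_unit _ _)) !compA.
  rewrite (comp2 _ (esym (lax_natural_l lF _ _))) !compA.
  rewrite (comp2 _ (esym (tensmM _ _ _ _))) w2_unit comp1m.
  rewrite -[eta z](comp1m) tensmM !compA (lax_assoc lF).
  rewrite (comp2 _ (assoc_natural _ _ _)) !compA.
  rewrite (comp2 _ (esym (adj_unit_natural _ _))) !compA.
  rewrite (comp2 _ (w2_unit _ _)) !compA -(lax_natural_r lF).
  rewrite [in RHS](comp2 _ (esym (tensmM _ _ _ _))).
  by rewrite w2_unit comp1m -[eta x in RHS]comp1m tensmM !compA.
- move=> x; apply: (adj_unit_inj (a := a)); rewrite !fmapM.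
  rewrite (comp2 _ (w2_unit _ _)) !compA.
  rewrite (comp2 _ (esym (lax_natural_l lF _ _))) !compA (comp2 _ (esym (tensmM _ _ _ _))).
  rewrite w0_unit comp1m -tensm_lr compA (lax_lunit lF).
  by rewrite lunit_natural adj_unit_natural.
- move=> x; apply: (adj_unit_inj (a := a)); rewrite !fmapM.
  rewrite (comp2 _ (w2_unit _ _)) !compA.
  rewrite (comp2 _ (esym (lax_natural_r lF _ _))) !compA (comp2 _ (esym (tensmM _ _ _ _))).
  rewrite w0_unit comp1m -tensm_rl compA (lax_runit lF).
  by rewrite runit_natural adj_unit_natural.
Qed.

End LeftAdjoint.

Section RightAdjoint.
Variables (R : linear_functor D C) (a : adjunction F R).
Local Notation eps := (adj_counit a).

Section Lax.
Variable m : lax_data R.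
Hypothesis m2_counit : forall x y,
  eps (x ⊗ y) ∘ fmap F (lax2 m x y) = (eps x ⊗ₘ eps y) ∘ F2i (R x) (R y).
Hypothesis m0_counit : eps one ∘ fmap F (lax0 m) = F0i.

(** Tested on the counit, each lax axiom becomes an oplax axiom of the inverse constraints of
    [F]. *)
Lemma right_adjoint_laxP : is_lax m.
Proof.
split.
- move=> x x' y y' f g; apply: (adj_inj (a := a)); rewrite !fmapM !compA.
  rewrite m2_counit adj_counit_natural (comp2 _ (m2_counit _ _)) !compA.
  by rewrite (comp2 _ (oplax_natural oF _ _)) !compA -!tensmM !adj_counit_natural.
- move=> x y z; apply: (adj_inj (a := a)); rewrite !fmapM !compA.
  rewrite adj_counit_natural (comp2 _ (m2_counit _ _)) !compA m2_counit.
  rewrite (comp2 _ (oplax_natural_l oF _ _)) (comp2 _ (oplax_natural_r oF _ _)) !compA.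
  rewrite (comp2 _ (esym (tensmM _ _ _ _))) m2_counit compm1.
  rewrite -[in RHS]tensmM m2_counit compm1.
  rewrite -[eps z](compm1) -[eps x in RHS](compm1) !tensmM !compA assoc_natural.
  rewrite !compm1 -!compA; congr (_ ∘ _).
  by rewrite !compA (oplax_assoc oF).
- move=> x; apply: (adj_inj (a := a)); rewrite !fmapM !compA.
  rewrite adj_counit_natural (comp2 _ (m2_counit _ _)) !compA.
  rewrite (comp2 _ (oplax_natural_l oF _ _)) !compA (comp2 _ (esym (tensmM _ _ _ _))).
  rewrite m0_counit compm1 -tensm_rl compA lunit_natural -(oplax_lunit oF).
  by rewrite !compA.
- move=> x; apply: (adj_inj (a := a)); rewrite !fmapM !compA.
  rewrite adj_counit_natural (comp2 _ (m2_counit _ _)) !compA.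
  rewrite (comp2 _ (oplax_natural_r oF _ _)) !compA (comp2 _ (esym (tensmM _ _ _ _))).
  rewrite m0_counit compm1 -tensm_lr compA runit_natural -(oplax_runit oF).
  by rewrite !compA.
Qed.

End Lax.
End RightAdjoint.
End StrongFunctors.

(** * The projection map *)

(** This is the map of the projection formula, which makes [R] a lax functor of left C-modules when
    C acts on D through [F]. *)
HB.lock Definition proj (k : fieldType) (C D : monoidal_category k)
    (F : tensor_functor C D) (R : linear_functor D C) (a : adjunction F R)
    (c : C) (d : D) : hom (c ⊗ R d) (R (F c ⊗ d)) :=
  fmap R ((idm (F c) ⊗ₘ adj_counit a d) ∘ oplax2 (tf_inv F) c (R d))
    ∘ adj_unit a (c ⊗ R d).

Section Projection.
Variables (k : fieldType) (C D : monoidal_category k) (F : tensor_functor C D).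
Variables (R : linear_functor D C) (a : adjunction F R).

Local Notation F2 := (lax2 (tf_lax F)).
Local Notation F2i := (oplax2 (tf_inv F)).
Local Notation F0 := (lax0 (tf_lax F)).
Local Notation F0i := (oplax0 (tf_inv F)).
Local Notation eps := (adj_counit a).
Local Notation eta := (adj_unit a).
Local Notation proj := (proj a).

Let oF := tensor_functor_oplax F.

Lemma proj_counit c d :
  eps (F c ⊗ d) ∘ fmap F (proj c d) = (idm (F c) ⊗ₘ eps d) ∘ F2i c (R d).
Proof. by rewrite proj.unlock adj_mates. Qed.

Lemma proj_natural c c' d d' (u : hom c c') (f : hom d d') :
  fmap R (fmap F u ⊗ₘ f) ∘ proj c d = proj c' d' ∘ (u ⊗ₘ fmap R f).
Proof.
apply: (adj_inj (a := a)); rewrite !fmapM !compA adj_counit_natural.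
rewrite (comp2 _ (proj_counit _ _)) proj_counit !compA -tensmM.
rewrite (comp2 _ (oplax_natural oF _ _)) !compA -tensmM adj_counit_natural.
by rewrite compm1 comp1m.
Qed.

Lemma proj_natural_l c c' d (u : hom c c') :
  fmap R (fmap F u ⊗ₘ idm d) ∘ proj c d = proj c' d ∘ (u ⊗ₘ idm (R d)).
Proof. by rewrite proj_natural fmap1. Qed.

Lemma proj_natural_r c d d' (f : hom d d') :
  fmap R (idm (F c) ⊗ₘ f) ∘ proj c d = proj c d' ∘ (idm c ⊗ₘ fmap R f).
Proof. by rewrite -proj_natural fmap1. Qed.

(** With [proj_unit], the coherence axioms of a lax module functor. *)
Lemma proj_assoc c c' d :
  proj c (F c' ⊗ d) ∘ (idm c ⊗ₘ proj c' d) ∘ assoc c c' (R d)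
  = fmap R (assoc (F c) (F c') d ∘ (F2i c c' ⊗ₘ idm d)) ∘ proj (c ⊗ c') d.
Proof.
apply: (adj_inj (a := a)); rewrite !(fmapM F) !compA adj_counit_natural !proj_counit.
rewrite (comp2 _ (oplax_natural_r oF _ _)) !compA (comp2 _ (proj_counit _ _)) !compA.
rewrite -tensmr proj_counit tensmr (comp2 _ (interchange _ _)) !compA assoc_r.
by rewrite -!compA; congr (_ ∘ _); rewrite !compA (oplax_assoc oF).
Qed.

Lemma proj_unit d :
  fmap R (lunit d ∘ (F0i ⊗ₘ idm d)) ∘ proj one d = lunit (R d).
Proof.
apply: (adj_inj (a := a)); rewrite !(fmapM F) !compA adj_counit_natural.
rewrite (comp2 _ (proj_counit _ _)) !compA (comp2 _ (interchange _ _)) !compA.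
by rewrite lunit_natural -(oplax_lunit oF) !compA.
Qed.

(** With [proj_coact], this says that [proj] intertwines duality in C with its image under [F]; the
    two equations are what inverts [proj]. *)
Lemma proj_act c c' (ev : hom (c' ⊗ c) one) d :
  fmap R (act (image_ev F ev) d) ∘ proj c' (F c ⊗ d) ∘ (idm c' ⊗ₘ proj c d)
  = act ev (R d).
Proof.
apply: (split_epi_cancel (assoc_invK c' c (R d))).
rewrite (comp3 _ (proj_assoc _ _ _)) compA -fmapM !act.unlock /image_ev.
rewrite !compA !tensml !compA !(comp2 _ (assocK _ _ _)) !compm1.
rewrite (comp2 _ (esym (tensml _ _ _))) F2iK tensm1 compm1.
by rewrite fmapM -compA proj_natural_l compA proj_unit.
Qed.

Lemma proj_coact c c' (coev : hom one (c ⊗ c')) d :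
  proj c (F c' ⊗ d) ∘ (idm c ⊗ₘ proj c' d) ∘ coact coev (R d)
  = fmap R (coact (image_coev F coev) d).
Proof.
rewrite !coact.unlock !compA proj_assoc (comp2 _ (esym (proj_natural_l _ _))).
rewrite !compA -fmapM.
apply: (split_epi_cancel (lunit_invK (R d))).
rewrite (comp2 _ (lunitK _)) compm1 -(proj_unit d) compA -fmapM; congr (fmap R _ ∘ _).
rewrite /image_coev !compA (comp2 _ (lunitK _)) compm1 !tensml !compA.
by rewrite [in RHS](comp2 _ (esym (tensml _ F0 F0i))) F0iK tensm1 compm1.
Qed.

(** Lax module functors over a rigid category are strong: the inverse is the transpose, under the
    adjunction of [c' ⊗ -] and [c ⊗ -], of [proj] at the dual [c'] followed by the image
    evaluation. *)
Lemma proj_iso c c' (ev : hom (c' ⊗ c) one) (coev : hom one (c ⊗ c')) d :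
  is_dual ev coev -> is_iso (proj c d).
Proof.
move=> dual; exists ((idm c ⊗ₘ (fmap R (act (image_ev F ev) d) ∘ proj c' (F c ⊗ d)))
  ∘ coact coev (R (F c ⊗ d))); split.
  rewrite (comp2 _ (coact_natural _ _)) !compA -tensmr proj_act.
  exact: coactK dual _.
rewrite compA tensmr compA -proj_natural_r.
rewrite (comp3 _ (proj_coact _ _)) -fmapM (coactK (image_dual F dual)).
exact: fmap1.
Qed.

(** Both sides have the same transpose under [a]. Thus the lax structure is accessible through
    [proj], which is natural and invertible. *)
Lemma lax2_proj (m : lax_data R) x y :
  eps (x ⊗ y) ∘ fmap F (lax2 m x y) = (eps x ⊗ₘ eps y) ∘ F2i (R x) (R y) ->
  lax2 m x y = fmap R (eps x ⊗ₘ idm y) ∘ proj (R x) y.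
Proof.
move=> m2; apply: (adj_inj (a := a)); rewrite m2 !fmapM !compA adj_counit_natural.
by rewrite (comp2 _ (proj_counit _ _)) !compA tensm_lr.
Qed.

End Projection.

(** * Frobenius forms *)

Section FrobeniusForm.
Variables (k : fieldType) (C D : monoidal_category k) (F : tensor_functor C D).
Variables (R : linear_functor D C) (a : adjunction F R).
Hypothesis rigidC : is_rigid C.

Local Notation F2 := (lax2 (tf_lax F)).
Local Notation F2i := (oplax2 (tf_inv F)).
Local Notation F0i := (oplax0 (tf_inv F)).
Local Notation proj := (proj a).

Definition is_frobenius_form (e : hom (R one) one) : Prop :=
  (forall d (h : hom (R d) one), exists f : hom d one, e ∘ fmap R f = h) /\
  (forall d (f g : hom d one), e ∘ fmap R f = e ∘ fmap R g -> f = g).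

Variable e : hom (R one) one.
Hypothesis formP : is_frobenius_form e.

Lemma proj_is_iso c d : is_iso (proj c d).
Proof. by have [[c' [ev [coev dual]]] _] := rigidC c; apply: proj_iso dual. Qed.

Let q c : hom (c ⊗ R one) (R (F c)) := fmap R (runit (F c)) ∘ proj c one.

Let q_natural c c' (u : hom c c') :
  fmap R (fmap F u) ∘ q c = q c' ∘ (u ⊗ₘ idm _).
Proof.
by rewrite /q compA -!fmapM -runit_natural fmapM -compA proj_natural_l compA.
Qed.

Let q_iso c : is_iso (q c).
Proof.
have [s [sK Ks]] := proj_is_iso c one.
exists (s ∘ fmap R (runit_inv (F c))); rewrite /q; split.
  by rewrite compA (comp2 _ (esym (fmapM _ _ _))) runitK fmap1 compm1.
by rewrite compA (comp2 _ Ks) compm1 -fmapM runit_invK fmap1.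
Qed.

(** The inverse of [q c] is only known to exist, so the counit is chosen by its defining equation;
    [==] again makes [xchoose] applicable. *)
Let counit_ex c : exists t : hom (R (F c)) c, t ∘ q c == runit c ∘ (idm c ⊗ₘ e).
Proof.
have [s [sK _]] := q_iso c.
by exists (runit c ∘ (idm c ⊗ₘ e) ∘ s); rewrite -compA sK compm1.
Qed.

Definition form_counit c : hom (R (F c)) c := xchoose (counit_ex c).
Local Notation eps' := form_counit.

Let counitP c : eps' c ∘ q c = runit c ∘ (idm c ⊗ₘ e).
Proof. exact/eqP/(xchooseP (counit_ex c)). Qed.

Lemma form_counit_natural c c' (u : hom c c') :
  eps' c' ∘ fmap R (fmap F u) = u ∘ eps' c.
Proof.
have [s [_ Ks]] := q_iso c; apply: (split_epi_cancel Ks).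
rewrite -compA q_natural compA counitP -!compA counitP -interchange !compA.
by rewrite runit_natural.
Qed.

(** This is the module property of the counit. Since [q c'] is invertible, it can be checked on
    [c ⊗ (c' ⊗ R one)], where [proj_assoc] reduces it to the defining equation at [c ⊗ c']. *)
Lemma form_counit_tens c c' :
  eps' (c ⊗ c') ∘ fmap R (F2 c c') ∘ proj c (F c') = idm c ⊗ₘ eps' c'.
Proof.
have [s [_ Ks]] := q_iso c'.
have K : (idm c ⊗ₘ q c') ∘ (idm c ⊗ₘ s) = idm _ by rewrite -tensmr Ks tensm1.
apply: (split_epi_cancel K); rewrite -tensmr counitP tensmr /q tensmr compA.
rewrite (comp2 _ (esym (proj_natural_r _ _ _))) !compA.
apply: (split_epi_cancel (assoc_invK c c' (R one))).
rewrite (comp3 _ (proj_assoc _ _ _ _)) !compA.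
have E : fmap R (F2 c c') ∘ fmap R (idm (F c) ⊗ₘ runit (F c'))
    ∘ fmap R (assoc (F c) (F c') one ∘ (F2i c c' ⊗ₘ idm one))
    = fmap R (runit (F (c ⊗ c'))).
  rewrite -!fmapM !compA (comp2 _ (runit_tens _ _)) -runit_natural.
  by rewrite (comp2 _ (esym (tensml _ _ _))) F2iK tensm1 compm1.
rewrite (comp3 _ E) -compA counitP (comp2 _ (esym (assoc_r _ _ _))) !compA.
by rewrite runit_tens.
Qed.

Lemma form_counit_one : eps' one = e ∘ fmap R F0i.
Proof.
have [s [_ Ks]] := q_iso one; apply: (split_epi_cancel Ks).
rewrite counitP -lunit_one lunit_natural -(proj_unit a one) /q !compA.
by congr (_ ∘ _); rewrite -!compA -!fmapM lunit_one runit_natural.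
Qed.

(** Pairing with a dual turns maps into [c] into maps into [one], which [e] controls; surjectivity
    and injectivity of transposition both reduce to those of the form through this equation. *)
Lemma form_counit_test c c' (ev : hom (c' ⊗ c) one) d (f : hom d (F c)) :
  ev ∘ (idm c' ⊗ₘ (eps' c ∘ fmap R f))
  = e ∘ fmap R (image_ev F ev ∘ (idm (F c') ⊗ₘ f)) ∘ proj c' d.
Proof.
rewrite tensmr compA -form_counit_tens !compA -form_counit_natural form_counit_one.
by rewrite (comp2 _ (esym (proj_natural_r _ _ _))) /image_ev !fmapM !compA.
Qed.

Lemma form_counit_surj d c (h : hom (R d) c) :
  exists f : hom d (F c), eps' c ∘ fmap R f == h.
Proof.
have [[c' [ev [coev dual]]] _] := rigidC c.
have [s [sK Ks]] := proj_is_iso c' d.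
have [f0 f0P] := formP.1 _ (ev ∘ (idm c' ⊗ₘ h) ∘ s).
have [f fP] := dual_transpose (image_dual F dual) f0.
exists f; apply/eqP/(dual_transpose_inj dual).
by rewrite form_counit_test fP f0P -compA sK compm1.
Qed.

Lemma form_counit_inj d c (f g : hom d (F c)) :
  eps' c ∘ fmap R f = eps' c ∘ fmap R g -> f = g.
Proof.
move=> fg; have [[c' [ev [coev dual]]] _] := rigidC c.
have [s [sK Ks]] := proj_is_iso c' d.
apply: (dual_transpose_inj (image_dual F dual)); apply: formP.2.
by apply: (split_epi_cancel Ks); rewrite -!form_counit_test fg.
Qed.

Definition form_adjunction : adjunction R F :=
  adjunction_of_universal form_counit_natural form_counit_surj form_counit_inj.

End FrobeniusForm.

(** * Frobenius relations *)

Section FrobeniusPairing.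
Variables (k : fieldType) (C D : monoidal_category k) (R : linear_functor D C).
Variables (m : lax_data R) (w : oplax_data R).
Hypotheses (mP : is_lax m) (wP : is_oplax w).
Hypothesis frobenius_right : forall x y z,
  (lax2 m x y ⊗ₘ idm (R z)) ∘ assoc_inv (R x) (R y) (R z)
    ∘ (idm (R x) ⊗ₘ oplax2 w y z)
  = oplax2 w (x ⊗ y) z ∘ fmap R (assoc_inv x y z) ∘ lax2 m x (y ⊗ z).

Definition frobenius_pairing x' x (ev : hom (x' ⊗ x) one) : hom (R x' ⊗ R x) one :=
  oplax0 w ∘ fmap R ev ∘ lax2 m x' x.
Local Notation pairing := frobenius_pairing.

(** The Frobenius relation followed by the oplax unit axiom: pairing trades the oplax constraint for
    the lax one. *)
Lemma pairing_oplax x' x (ev : hom (x' ⊗ x) one) y :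
  act (pairing ev) (R y) ∘ (idm (R x') ⊗ₘ oplax2 w x y)
  = fmap R (act ev y) ∘ lax2 m x' (x ⊗ y).
Proof.
rewrite /frobenius_pairing !act.unlock !tensml !compA (comp3 _ (frobenius_right _ _ _)).
rewrite !compA (comp2 _ (esym (oplax_natural_l wP _ _))) !compA (oplax_lunit wP).
by rewrite !fmapM.
Qed.

(** Every functional [h] on [R y] is pairing with an element of [R x]: the coevaluation is carried
    through [R] by the oplax and lax structures, and [pairing_oplax] reduces the check to the snake
    identity [act_coev]. *)
Lemma pairing_coev y x (ev : hom (y ⊗ x) one) coev (h : hom (R y) one) :
  is_dual ev coev ->
  pairing ev ∘ (idm (R y) ⊗ₘ (runit (R x) ∘ (idm (R x) ⊗ₘ h) ∘ oplax2 w x y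
    ∘ fmap R coev ∘ lax0 m))
  = h ∘ runit (R y).
Proof.
move=> dual; rewrite !tensmr !compA ev_runit act_natural (comp2 _ (pairing_oplax _ _)).
rewrite !compA (comp2 _ (lax_natural_r mP _ _)) !compA.
rewrite (comp2 _ (esym (fmapM R _ _))) (act_coev dual).
by rewrite -(lax_runit mP) !compA.
Qed.

End FrobeniusPairing.

Section FrobeniusMonoidal.
Variables (k : fieldType) (C D : monoidal_category k) (F : tensor_functor C D).
Variables (R : linear_functor D C) (a : adjunction F R) (a' : adjunction R F).
Hypotheses (rigidC : is_rigid C) (rigidD : is_rigid D).

Local Notation F2 := (lax2 (tf_lax F)).
Local Notation F2i := (oplax2 (tf_inv F)).
Local Notation F0 := (lax0 (tf_lax F)).
Local Notation F0i := (oplax0 (tf_inv F)).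
Local Notation eps := (adj_counit a).
Local Notation eta := (adj_unit a).
Local Notation eps' := (adj_counit a').
Local Notation eta' := (adj_unit a').
Local Notation proj := (proj a).

Hypothesis counit_tens : forall c c',
  eps' (c ⊗ c') ∘ fmap R (F2 c c') ∘ proj c (F c') = idm c ⊗ₘ eps' c'.

Variables (m : lax_data R) (w : oplax_data R).
Hypothesis m2_counit : forall x y,
  eps (x ⊗ y) ∘ fmap F (lax2 m x y) = (eps x ⊗ₘ eps y) ∘ F2i (R x) (R y).
Hypothesis m0_counit : eps one ∘ fmap F (lax0 m) = F0i.
Hypothesis w2_unit : forall x y,
  fmap F (oplax2 w x y) ∘ eta' (x ⊗ y) = F2 (R x) (R y) ∘ (eta' x ⊗ₘ eta' y).
Hypothesis w0_unit : fmap F (oplax0 w) ∘ eta' one = F0.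

Local Notation m2 := (lax2 m).
Local Notation w2 := (oplax2 w).

Let lF := strong_lax (tf_strong F).
Let mP : is_lax m := right_adjoint_laxP m2_counit m0_counit.
Let wP : is_oplax w := left_adjoint_oplaxP w2_unit w0_unit.

Let w2E x y :
  w2 x y = eps' (R x ⊗ R y) ∘ fmap R (F2 (R x) (R y)) ∘ fmap R (eta' x ⊗ₘ eta' y).
Proof. by rewrite -compA -fmapM -w2_unit adj_mates. Qed.

Let w0E : oplax0 w = eps' one ∘ fmap R F0.
Proof. by rewrite -w0_unit adj_mates. Qed.

(** This is the mate of [counit_tens]: transposed under [a'] and precomposed with the invertible
    [proj], both sides become [m2 x y]. *)
Let m2_unit x y :
  fmap F (m2 x y) ∘ F2 (R x) (R y) ∘ (idm (F (R x)) ⊗ₘ eta' y)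
  = eta' (x ⊗ y) ∘ (eps x ⊗ₘ idm y).
Proof.
have [s [_ Ks]] := proj_is_iso a rigidC (R x) y.
have inj (u v : hom (F (R x) ⊗ y) (F (R (x ⊗ y)))) :
    eps' _ ∘ fmap R u = eps' _ ∘ fmap R v -> u = v.
  by move=> uv; rewrite -(adj_mates' a' u) uv adj_mates'.
apply: inj; apply: (split_epi_cancel Ks).
rewrite !fmapM !compA adj_triangle_left comp1m adj_counit_natural.
rewrite (comp2 _ (proj_natural_r _ _ _)) !compA (comp3 _ (counit_tens _ _)).
rewrite (comp2 _ (esym (tensmr _ _ _))) adj_triangle_left tensm1 compm1.
by rewrite (lax2_proj (m2_counit _ _)).
Qed.

(** Writing [w2] through the counit [eps'] and using [counit_tens] brings everything under [R],
    where [m2_unit] and coherence of [F] finish. *)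
Lemma frobenius_right x y z :
  (m2 x y ⊗ₘ idm (R z)) ∘ assoc_inv (R x) (R y) (R z) ∘ (idm (R x) ⊗ₘ w2 y z)
  = w2 (x ⊗ y) z ∘ fmap R (assoc_inv x y z) ∘ m2 x (y ⊗ z).
Proof.
rewrite !w2E !tensmr !compA -counit_tens !compA.
rewrite !(comp2 _ (esym (proj_natural_r _ _ _))) !compA.
rewrite !(comp2 _ (esym (proj_natural_r _ _ _))) !compA.
(* Both sides now begin with [proj (R x) (y ⊗ z)]; after its removal, naturality of [eps'] leaves an
   equation in D. *)
rewrite (lax2_proj (m2_counit x (y ⊗ z))) !compA; congr (_ ∘ _).
rewrite (comp2 _ (esym (adj_counit_natural a' _))) !compA.
rewrite -(adj_counit_natural a') -!compA -!fmapM; congr (_ ∘ fmap R _).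
rewrite !compA (comp3 _ (lax_assoc_inv lF _ _ _)) !compA.
rewrite (comp2 _ (assoc_inv_natural _ _ _)) (comp2 _ (assoc_inv_l _ _ _)) !compA.
congr (_ ∘ _); rewrite -(lax_natural_l lF) -!compA -!tensmM !compA.
by rewrite m2_unit !comp1m compm1.
Qed.

Local Notation pairing := (frobenius_pairing m w).

(** Nondegeneracy of the pairing, by a chain of transpositions: [c ⊗ R x] is [R (F c ⊗ x)], then
    [a'] gives a map [F c ⊗ x -> F one], duality in D a map [F c -> x'], and [a] a map
    [c -> R x']. *)
Let pairing_universal x' x (ev : hom (x' ⊗ x) one) coev c (h : hom (c ⊗ R x) one) :
  is_dual ev coev -> exists g : hom c (R x'), pairing ev ∘ (g ⊗ₘ idm (R x)) = h.
Proof.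
move=> dual; have [s [sK _]] := proj_is_iso a rigidC c x.
pose f1 : hom (F c ⊗ x) (F one) := fmap F (h ∘ s) ∘ eta' (F c ⊗ x).
have f1P : eps' one ∘ fmap R f1 = h ∘ s by apply: adj_mates.
have [f fP] := dual_transpose_left dual (F0i ∘ f1).
exists (fmap R f ∘ eta c).
rewrite /frobenius_pairing (lax2_proj (m2_counit _ _)) !compA.
rewrite (comp2 _ (esym (proj_natural_l _ _ _))) w0E !compA.
have E : fmap R F0 ∘ fmap R ev ∘ fmap R (eps x' ⊗ₘ idm x)
    ∘ fmap R (fmap F (fmap R f ∘ eta c) ⊗ₘ idm x) = fmap R f1.
  by rewrite -!fmapM -!compA -tensml adj_mates fP compA F0iK comp1m.
by rewrite (comp4 _ E) f1P -compA sK compm1.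
Qed.

(** By [pairing_universal] the evaluation of an actual dual of [R x] factors through the pairing, so
    [act_detects] applies. *)
Let pairing_detects x' x (ev : hom (x' ⊗ x) one) coev v z (f g : hom v (R x ⊗ z)) :
  is_dual ev coev ->
  act (pairing ev) z ∘ (idm (R x') ⊗ₘ f) = act (pairing ev) z ∘ (idm (R x') ⊗ₘ g) ->
  f = g.
Proof.
move=> dual fg; have [[p [evX [coevX dualX]]] _] := rigidC (R x).
have [t tP] := pairing_universal evX dual.
apply: (act_detects dualX); rewrite -tP -!act_dom.
by rewrite -!compA !interchange !compA fg.
Qed.

(** After pairing with [R x'], [pairing_oplax] removes [w2] from both sides, and what remains is
    associativity of [m2]. *)
Lemma frobenius_left x y z :
  (idm (R x) ⊗ₘ m2 y z) ∘ assoc (R x) (R y) (R z) ∘ (w2 x y ⊗ₘ idm (R z))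
  = w2 x (y ⊗ z) ∘ fmap R (assoc x y z) ∘ m2 (x ⊗ y) z.
Proof.
have [[x' [ev [coev dual]]] _] := rigidD x.
apply: (pairing_detects dual); rewrite !tensmr !compA act_natural.
rewrite (comp2 _ (act_tens _ _ _)) !compA (comp2 _ (assoc_inv_natural _ _ _)) !compA.
rewrite (comp2 _ (esym (tensml _ _ _))) (pairing_oplax wP frobenius_right) tensml !compA.
rewrite (lax_natural_l mP) (comp3 _ (esym (lax_assoc_inv mP _ _ _))) !compA.
rewrite (pairing_oplax wP frobenius_right) (comp2 _ (lax_natural_r mP _ _)) !compA -!fmapM.
by rewrite act_tens.
Qed.

Lemma induced_frobenius_monoidal : is_frobenius_monoidal m w.
Proof.
by split; [exact: mP | exact: wP | exact: frobenius_left | exact: frobenius_right].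
Qed.

End FrobeniusMonoidal.

(** * Frobenius forms from either hypothesis *)

Section FrobeniusForms.
Variables (k : fieldType) (C D : monoidal_category k) (F : tensor_functor C D).
Variables (R : linear_functor D C) (a : adjunction F R).

Local Notation F0 := (lax0 (tf_lax F)).
Local Notation F0i := (oplax0 (tf_inv F)).
Local Notation eps := (adj_counit a).
Local Notation eta := (adj_unit a).

(** Duality turns maps [d -> one] into elements [one -> d'], and the pairing turns maps [R d -> one]
    into elements [one -> R d']; the adjunction [a] and [F one ≅ one] match the two kinds of
    elements. *)
Lemma frobenius_monoidal_form (m : lax_data R) (w : oplax_data R) :
  is_rigid D -> eps one ∘ fmap F (lax0 m) = F0i -> is_frobenius_monoidal m w ->
  is_frobenius_form (oplax0 w).
Proof.
move=> rigidD m0_counit [mP wP _ frob].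
have m0E : lax0 m = fmap R F0i ∘ eta one by rewrite -m0_counit adj_mates'.
split=> d.
- move=> h; have [_ [d' [ev [coev dual]]]] := rigidD d.
  have gP := pairing_coev mP wP frob h dual.
  set g := (X in idm _ ⊗ₘ X) in gP.
  (* The element of [d'] corresponding to [g] under [a]. *)
  pose g' := eps d' ∘ fmap F g ∘ F0.
  have g'P : fmap R g' ∘ lax0 m = g.
    rewrite m0E compA -fmapM (comp2 _ (F0iK F)) compm1.
    exact: adj_mates'.
  exists (ev ∘ (idm d ⊗ₘ g') ∘ runit_inv d).
  apply: (split_epi_cancel (runit_invK (R d))).
  rewrite -gP -g'P /frobenius_pairing tensmr !compA.
  rewrite (comp2 _ (lax_natural_r mP _ _)) -(lax_runit mP) !compA !fmapM !compA.
  by rewrite (comp2 _ (esym (fmapM R _ _))) runitK fmap1 compm1.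
- have [_ [d' [ev [coev dual]]]] := rigidD d.
  (* The dual transpose of [f] is rewritten so that [f] enters only through [oplax0 w ∘ fmap R f],
     by the oplax unit axiom. *)
  have E (f : hom d one) : runit d' ∘ (idm d' ⊗ₘ f) ∘ coev ∘ F0i
      = eps d' ∘ fmap F (runit (R d') ∘ (idm (R d') ⊗ₘ (oplax0 w ∘ fmap R f))
        ∘ oplax2 w d' d ∘ fmap R coev ∘ lax0 m).
    rewrite tensmr !compA (comp2 _ (esym (oplax_natural_r wP _ _))) !compA.
    by rewrite (oplax_runit wP) m0E !compA -!(fmapM R) adj_mates.
  (* The snake identity recovers [f] from its dual transpose. *)
  have E' (f : hom d one) : f = ev ∘ (idm d ⊗ₘ (runit d' ∘ (idm d' ⊗ₘ f) ∘ coev))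
       ∘ runit_inv d.
    rewrite !tensmr !compA ev_runit act_natural (comp2 _ (act_coev dual)).
    by rewrite (comp2 _ (runit_invK _)) compm1.
  move=> f g fg; rewrite (E' f) (E' g); congr (ev ∘ (idm d ⊗ₘ _) ∘ _).
  by apply: (split_epi_cancel (F0K F)); rewrite !E fg.
Qed.

(** Up to [psi], the map [f |-> e ∘ R f] is the transposition of [b] applied to [F0 ∘ f], hence
    bijective since [F0] is invertible. *)
Lemma left_adjoint_form (L : linear_functor D C) (b : adjunction L F)
    (psi : nat_iso R L) :
  is_frobenius_form (adj_counit b one ∘ fmap L F0 ∘ psi one).
Proof.
have E d (f : hom d one) : adj_counit b one ∘ fmap L F0 ∘ psi one ∘ fmap R f
    = adj_counit b one ∘ fmap L (F0 ∘ f) ∘ psi d.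
  by rewrite (comp2 _ (nat_natural psi f)) fmapM !compA.
split=> d.
  move=> h; exists (F0i ∘ (fmap F (h ∘ nat_inv psi d) ∘ adj_unit b d)).
  rewrite E [F0 ∘ _]compA F0iK comp1m adj_mates -compA nat_invK.
  exact: compm1.
move=> f g; rewrite !E => fg; apply: (split_mono_cancel (F0K F)).
have {fg} fg := split_epi_cancel (nat_funK psi d) fg.
by rewrite -(adj_mates' b (F0 ∘ f)) fg adj_mates'.
Qed.

End FrobeniusForms.

(** * Unit and counit equations of the induced structures *)

Section InducedCounits.
Variables (k : fieldType) (C D : monoidal_category k) (F : tensor_functor C D).

Lemma right_adjoint_lax2_counit (R : linear_functor D C) (a : adjunction F R) x y :
  adj_counit a (x ⊗ y) ∘ fmap F (lax2 (right_adjoint_lax a) x y)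
  = (adj_counit a x ⊗ₘ adj_counit a y) ∘ oplax2 (tf_inv F) (R x) (R y).
Proof. exact: adj_mates. Qed.

Lemma right_adjoint_lax0_counit (R : linear_functor D C) (a : adjunction F R) :
  adj_counit a one ∘ fmap F (lax0 (right_adjoint_lax a)) = oplax0 (tf_inv F).
Proof. exact: adj_mates. Qed.

Variables (L L' : linear_functor D C) (a : adjunction L F) (a' : adjunction L' F).
Local Notation phi := (left_adjoint_iso a a').
Local Notation w := (transport_oplax phi (left_adjoint_oplax a)).

Let unit_inv d : fmap F (nat_inv phi d) ∘ adj_unit a' d = adj_unit a d.
Proof. exact: left_adjoint_map_unit. Qed.

(** The comparison isomorphism preserves units, so the structure transported from [L] satisfies the
    unit equation of [L'] for its own adjunction [a']. *)
Lemma transport_oplax2_unit x y :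
  fmap F (oplax2 w x y) ∘ adj_unit a' (x ⊗ y)
  = lax2 (tf_lax F) (L' x) (L' y) ∘ (adj_unit a' x ⊗ₘ adj_unit a' y).
Proof.
have E : fmap F (oplax2 (left_adjoint_oplax a) x y) ∘ adj_unit a (x ⊗ y)
    = lax2 (tf_lax F) (L x) (L y) ∘ (adj_unit a x ⊗ₘ adj_unit a y).
  exact: adj_mates'.
have -> : fmap F (oplax2 w x y) = fmap F (phi x ⊗ₘ phi y)
    ∘ fmap F (oplax2 (left_adjoint_oplax a) x y) ∘ fmap F (nat_inv phi (x ⊗ y)).
  by rewrite -!fmapM.
rewrite (comp2 _ (unit_inv _)) (comp2 _ E) !compA.
rewrite -(lax_natural (strong_lax (tf_strong F))) -compA -tensmM.
by rewrite !left_adjoint_map_unit.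
Qed.

Lemma transport_oplax0_unit : fmap F (oplax0 w) ∘ adj_unit a' one = lax0 (tf_lax F).
Proof. by rewrite fmapM -compA unit_inv; apply: adj_mates'. Qed.

End InducedCounits.

Theorem proposition3p7 (k : closedFieldType) (C D : finite_tensor_category k)
    (F : tensor_functor C D) (R : linear_functor D C) (adjR : adjunction F R) :
  ((exists w : oplax_data R, is_frobenius_monoidal (right_adjoint_lax adjR) w) ->
   is_frobenius F)
  /\
  (is_exact R -> is_faithful R -> is_frobenius F ->
   forall (L : linear_functor D C) (adjL : adjunction L F),
   exists phi : nat_iso L R,
     is_frobenius_monoidal (right_adjoint_lax adjR)
       (transport_oplax phi (left_adjoint_oplax adjL))).
Proof.
have rigidC : is_rigid C := ftc_rigid (f := C).
have rigidD : is_rigid D := ftc_rigid (f := D).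
split.
  move=> [w frob].
  have formP := frobenius_monoidal_form rigidD (right_adjoint_lax0_counit adjR) frob.
  (* The form makes [R] itself a left adjoint, so the required isomorphism is the identity. *)
  exists R, R; split; [|exact: inhabits|exact: (inhabits (nat_iso_refl R))].
  exact: (inhabits (form_adjunction adjR rigidC formP)).
move=> _ _ [L0 [R0 [[b] [a0] [phi0]]]] L adjL.
(* The adjoints witnessing that [F] is Frobenius need not be the given ones; [psi] identifies [R]
   with [L0], whose counit supplies the form. *)
have psi := nat_iso_trans (right_adjoint_iso adjR a0) (nat_iso_sym phi0).
have formP := left_adjoint_form b psi.
(* The adjunction carried over along [psi] need not respect the module structure, so it is rebuilt
   from its form; [phi] then compares [L] with [R] through the rebuilt adjunction. *)
pose adjR' := form_adjunction adjR rigidC formP.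
exists (left_adjoint_iso adjL adjR').
apply: (induced_frobenius_monoidal (a := adjR) (a' := adjR')) => //.
- exact: form_counit_tens.
- exact: right_adjoint_lax2_counit.
- exact: right_adjoint_lax0_counit.
- exact: transport_oplax2_unit.
- exact: transport_oplax0_unit.
Qed.
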